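(* In the SPEnKF, the application of the sequential step-wise inflation factors $$\phi_{i+1}=\frac{\theta_{i+1}(S_i\theta_ip_0+r)}{\theta_i(S_i\theta_{i+1}p_0+r)}$$ to the forecast variance at the $(i+1)$-th step, $p^{\mathrm f}_{i+1}\leftarrow\phi_{i+1}p^{\mathrm f}_{i+1}$, for all $i$, with $\phi_0=\theta_0$ being applied at the initial time, together with the sequential addition of the step-wise correction factor $$\psi_{i+1}=\frac{M_{i+1}(B_i-S_i\tilde x_0)(\theta_{i+1}-\theta_i)p_0r}{(S_i\theta_{i+1}p_0+r)(S_i\theta_ip_0+r)}$$ to the forecast mean at the $(i+1)$-th step, $x^{\mathrm f}_{i+1}\leftarrow\psi_{i+1}+x^{\mathrm f}_{i+1}$, is equivalent to applying $\theta_{i+1}$ at the initial onset of the algorithm.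
   Context: Let $m_0,m_1,\dots$ be nonzero reals (the scalar model), $r>0$ (observation error variance), $p_0>0$, $\tilde x_0\in\mathbb{R}$, $1<\alpha<\infty$, and let $y_0,y_1,\dots$ be real observations. Set (empty products $=1$) $M_i=\prod_{j=0}^{i-1}m_j$, $S_i=\sum_{l=0}^iM_l^2$, $B_i=\sum_{l=0}^iM_ly_l$. Scalar filter recursion: from an initial forecast mean $x^{\mathrm f}_0$ and variance $p^{\mathrm f}_0$, for $i\ge0$ the analysis is $k_i=\frac{p^{\mathrm f}_i}{p^{\mathrm f}_i+r}$, $x^{\mathrm a}_i=x^{\mathrm f}_i+k_i(y_i-x^{\mathrm f}_i)$, $p^{\mathrm a}_i=(1-k_i)p^{\mathrm f}_i$, followed by the forecast $x^{\mathrm f}_{i+1}=m_ix^{\mathrm a}_i$, $p^{\mathrm f}_{i+1}=m_i^2p^{\mathrm a}_i$. The exact scalar Kalman filter has input variance $p_0$. The SPEnKF (Scalar Pedagogical Ensemble Kalman Filter) with input mean $\tilde x_0$, input variance $\tilde p_0$ and ensemble size $N=2\alpha$ follows this recursion with initial mean $\tilde x_0$ and initial variance equal to the sample variance $\frac1N\sum_{j=1}^N a_j^2\sim\Gamma(\alpha,\alpha/\tilde p_0)$ (shape, rate) of $N$ anomalies $a_j$ sampled from $\mathcal N(0,\tilde p_0)$; in the claim, $p^{\mathrm f}_{i+1}$ and $x^{\mathrm f}_{i+1}$ are the forecast variance and mean of this algorithm. The optimal step-wise initial inflation factor $\theta_i$ is the factor such that, when $\tilde p_0=\theta_ip_0$,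 the expected difference between the SPEnKF analysis variance and the exact Kalman filter analysis variance at step $i$ is zero; explicitly $$\theta_i=\left[\frac{S_ip_0}{\alpha r}\,\mathfrak E_{\alpha+1}^{-1}\left(\frac{S_ip_0}{\alpha(S_ip_0+r)}\right)\right]^{-1},$$ where $\mathfrak E_{\alpha+1}(z)=e^zE_{\alpha+1}(z)$, $E_n(z)=\int_1^\infty e^{-zt}t^{-n}dt$, and $\mathfrak E_{\alpha+1}^{-1}$, defined on $(0,\alpha^{-1}]$, is the inverse of the strictly decreasing function $\mathfrak E_{\alpha+1}$ on $[0,\infty)$. Applying $\theta_{i+1}$ at the initial onset means using the initial inflation $\tilde p_0=\theta_{i+1}p_0$.
   Formalization: The filter is started at the input variance itself (the mean of the Gamma law) instead of the random sample variance; with a random sample variance different from the input variance the stated factors do not give the claimed equivalence unless consecutive inflation factors coincide. *)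

(* Defs.v *)
From HB Require Import structures.
From mathcomp Require Import all_boot all_order all_algebra.
From mathcomp Require Import all_classical all_reals all_analysis.

Set Implicit Arguments.
Unset Strict Implicit.
Unset Printing Implicit Defensive.

Import Order.TTheory GRing.Theory Num.Theory.
Import numFieldNormedType.Exports.

Local Open Scope classical_set_scope.
Local Open Scope ring_scope.

Section Filter.
Context {R : realType}.

Definition kalman_gain (r p : R) : R := p / (p + r).

(* A filter state is a pair (mean, variance). *)
Definition analysis (r y : R) (s : R * R) : R * R :=
  (s.1 + kalman_gain r s.2 * (y - s.1), (1 - kalman_gain r s.2) * s.2).

Definition forecast (m : R) (s : R * R) : R * R :=
  (m * s.1, m ^+ 2 * s.2).

(* Forecast state (x^f_i, p^f_i) of the scalar filter started at the initial
   forecast mean x0 and the initial forecast variance v0. *)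
Fixpoint filter_forecast (r : R) (m y : nat -> R) (x0 v0 : R) (i : nat) :
    R * R :=
  if i is j.+1 then
    forecast (m j) (analysis r (y j) (filter_forecast r m y x0 v0 j))
  else (x0, v0).

(* The same recursion in which every forecast is corrected before it is used
   by the next analysis: p^f_i <- phi i * p^f_i for all i >= 0 (at i = 0 this
   acts on the initial variance v0), and x^f_i <- psi i + x^f_i for all i >= 1
   (the value psi 0 is never used). *)
Fixpoint corrected_forecast (r : R) (m y phi psi : nat -> R) (x0 v0 : R)
    (i : nat) : R * R :=
  if i is j.+1 then
    let f := forecast (m j)
      (analysis r (y j) (corrected_forecast r m y phi psi x0 v0 j)) in
    (psi j.+1 + f.1, phi j.+1 * f.2)
  else (x0, phi 0%N * v0).

Definition model_prod (m : nat -> R) (i : nat) : R := \prod_(j < i) m j.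

Definition sum_sq (m : nat -> R) (i : nat) : R :=
  \sum_(l < i.+1) model_prod m l ^+ 2.

Definition sum_obs (m y : nat -> R) (i : nat) : R :=
  \sum_(l < i.+1) model_prod m l * y l.

Definition expint (n z : R) : R :=
  Rintegral lebesgue_measure `[1, +oo[ (fun t => expR (- (z * t)) * t `^ (- n)).

Definition scaled_expint (n z : R) : R := expR z * expint n z.

(* Inverse of scaled_expint n restricted to [0, +oo[; off the image of that
   half-line it takes a default value. *)
Definition scaled_expint_inv (n : R) : R -> R :=
  pinv [set z : R | 0 <= z] (scaled_expint n).

Definition opt_inflation (alpha r p0 : R) (m : nat -> R) (i : nat) : R :=
  (sum_sq m i * p0 / (alpha * r) *
   scaled_expint_inv (alpha + 1)
     (sum_sq m i * p0 / (alpha * (sum_sq m i * p0 + r))))^-1.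

Definition inflation_factor (alpha r p0 : R) (m : nat -> R) (i : nat) : R :=
  let theta := opt_inflation alpha r p0 m in
  if i is j.+1 then
    (theta j.+1 * (sum_sq m j * theta j * p0 + r)) /
    (theta j * (sum_sq m j * theta j.+1 * p0 + r))
  else theta 0%N.

Definition mean_correction (alpha r p0 x0 : R) (m y : nat -> R) (i : nat) : R :=
  let theta := opt_inflation alpha r p0 m in
  if i is j.+1 then
    (model_prod m j.+1 * (sum_obs m y j - sum_sq m j * x0) *
       (theta j.+1 - theta j) * p0 * r) /
    ((sum_sq m j * theta j.+1 * p0 + r) * (sum_sq m j * theta j * p0 + r))
  else 0.

(* SPEnKF forecast state at step i for input mean x0 and input variance pt.
   The recursion is started at the nominal value pt of the initial variance,
   i.e. at the mean of the sample variance, whose law is Gamma(alpha, alpha/pt):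
   the factors below are functions of the input variance only.  If the sample
   variance were g * pt with g != 1, the factors turning the run for
   theta_j * p0 into the run for theta_j.+1 * p0 would depend on g (unless
   theta_j = theta_j.+1). *)
Definition spenkf (r : R) (m y : nat -> R) (x0 pt : R) (i : nat) : R * R :=
  filter_forecast r m y x0 pt i.

(* SPEnKF with input variance p0, to which the step-wise inflation factors and
   mean corrections are applied sequentially. *)
Definition spenkf_sequential (alpha r p0 : R) (m y : nat -> R) (x0 : R)
    (i : nat) : R * R :=
  corrected_forecast r m y (inflation_factor alpha r p0 m)
    (mean_correction alpha r p0 x0 m y) x0 p0 i.

End Filter.

(* Main.v *)
(* Started at (x0, v), the recursion has the closed form
     x^f_{i+1} = M_{i+1} (r x0 + v B_i) / (S_i v + r),
     p^f_{i+1} = M_{i+1}^2 v r / (S_i v + r),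
   so phi_{i+1} is the ratio, and psi_{i+1} the difference, of its values at
   v = theta_{i+1} p0 and v = theta_i p0.  This needs theta_i > 0 (a junk value
   theta_i = 0 would turn phi_{i+1} into 0), i.e. that the inverse of
   e^z E_{alpha+1}(z) is really attained at a positive point: this function is
   continuous, equals 1/alpha at 0 and is at most 1/z for z > 0. *)
Require Import Defs.
From mathcomp Require Import all_boot all_order all_algebra.
From mathcomp Require Import all_classical all_reals all_analysis.
From mathcomp Require Import measurable_realfun ring.
Import Order.TTheory GRing.Theory Num.Theory.
Import numFieldNormedType.Exports.
Local Open Scope classical_set_scope.
Local Open Scope ring_scope.

(** * Analysis of [e^z E_{a+1}(z)] on the half-line [z >= 0] *)

Section ScaledExpint.
Context {R : realType}.
Local Notation mu := (@lebesgue_measure R).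

(** Since [f] is its own absolute value on the half-line, the improper fundamental theorem evaluates
    the integral of the norm as [l - F a], which is finite. *)
Lemma ge0_integrable_FTC2y (f F : R -> R) (a l : R) :
  (forall x, a <= x -> 0 <= f x) ->
  {within `[a, +oo[, continuous f} ->
  F x @[x --> +oo] --> l ->
  (forall x, a < x -> derivable F x 1) -> F x @[x --> a^'+] --> F a ->
  {in `]a, +oo[, F^`()%classic =1 f} ->
  mu.-integrable `[a, +oo[ (EFin \o f).
Proof.
move=> f0 cf Fl dF Fa dFE; apply/integrableP; split.
  by apply/measurable_EFinP; exact: subspace_continuous_measurable_fun.
under eq_integral => x.
  rewrite inE/= in_itv/= andbT => ax.
  rewrite /= ger0_norm ?f0//.
  over.
by rewrite (ge0_continuous_FTC2y f0 cf Fl dF Fa dFE) -EFinB ltry.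
Qed.

(** For [x > 0] the power is [expR (- (- a * ln x))], and [- a * ln x] tends to infinity. *)
Lemma powR_cvgy0 (a : R) : a < 0 -> x `^ a @[x --> +oo] --> 0.
Proof.
move=> a0; have Na0 : 0 < - a by rewrite oppr_gt0.
apply: (@cvg_trans _ (expR (- (- a * ln x)) @[x --> +oo])).
  apply: near_eq_cvg; near=> x.
  by rewrite /powR gt_eqF ?mulNr ?opprK.
apply: (@cvg_comp _ _ _ (fun x => - a * ln x) (fun x => expR (- x)) _
  (pinfty_nbhs R)); last exact: cvgr_expR.
apply: gt0_cvgMry => //; apply/cvgryPge => A.
near=> x.
rewrite -(expRK A) ler_ln ?posrE ?expR_gt0//.
Unshelve. all: end_near. Qed.

Lemma continuous_powR_pos (a x : R) : 0 < x ->
  {for x, continuous (fun t => t `^ a)}.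
Proof.
move=> x0; apply: differentiable_continuous.
by apply/derivable1_diffP; apply: derivable_powR; rewrite in_itv/= x0.
Qed.

Lemma within_continuous_powR (a : R) :
  {within `[1, +oo[, continuous (fun t : R => t `^ a)}.
Proof.
apply: continuous_in_subspaceT => x; rewrite inE/= in_itv/= andbT => x1.
by apply: continuous_powR_pos; rewrite (lt_le_trans _ x1).
Qed.

Let antiderivative (a t : R) := - a^-1 * t `^ (- a).

Let antiderivative_derivable (a t : R) : 0 < t -> 0 < a ->
  is_derive t 1 (antiderivative a) (t `^ (- (a + 1))).
Proof.
move=> t0 a0.
have -> : t `^ (- (a + 1)) = - a^-1 *: (- a * t `^ (- a - 1)).
  by rewrite opprD /GRing.scale/= mulrA mulrNN mulVf ?mul1r// gt_eqF.
by apply: is_deriveZ; exact: is_derive1_powR.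
Qed.

(** The integrand of [expint (a + 1)] at [z = 0]: its integral gives the value there, and its
    integrability dominates the integrands for all [z >= 0]. *)
Lemma integral_powR_tail (a : R) : 0 < a ->
  mu.-integrable `[1, +oo[ (EFin \o (fun t : R => t `^ (- (a + 1)))) /\
  (\int[mu]_(t in `[1, +oo[) t `^ (- (a + 1)) = a^-1)%R.
Proof.
move=> a0.
have h1 (x : R) : 1 <= x -> 0 <= x `^ (- (a + 1)) by move=> _; exact: powR_ge0.
have h2 := within_continuous_powR (- (a + 1)).
have h3 : antiderivative a x @[x --> +oo] --> 0.
  by rewrite -[0](mulr0 (- a^-1)); apply: cvgMr; apply: powR_cvgy0; rewrite oppr_lt0.
have h4 (x : R) : 1 < x -> derivable (antiderivative a) x 1.
  move=> x1; have x0 := lt_trans ltr01 x1.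
  by have [] := antiderivative_derivable a x x0 a0.
have h5 : antiderivative a x @[x --> 1^'+] --> antiderivative a 1.
  apply: cvg_at_right_filter.
  by apply: cvgMr; exact: continuous_powR_pos.
have h6 : {in `]1, +oo[, (antiderivative a)^`()%classic =1 (fun t => t `^ (- (a + 1)))}.
  move=> x; rewrite in_itv/= andbT => x1; rewrite derive1E.
  by have [] := antiderivative_derivable a x (lt_trans ltr01 x1) a0.
split; first exact: ge0_integrable_FTC2y h1 h2 h3 h4 h5 h6.
rewrite (Rintegral_ge0_continuous_FTC2y h1 h2 h3 h4 h5 h6).
by rewrite /antiderivative powR1 mulr1 sub0r opprK.
Qed.

(** The comparison integral behind the bound of [scaled_expint] by [z^-1]. *)
Lemma integral_expR_tail (b : R) : 0 < b ->
  mu.-integrable `[1, +oo[ (EFin \o (fun t : R => expR (- (b * t)))) /\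
  (\int[mu]_(t in `[1, +oo[) expR (- (b * t)) = b^-1 * expR (- b))%R.
Proof.
move=> b0.
pose F (t : R) := - b^-1 * expR (- (b * t)).
have dF (x : R) : is_derive x 1 F (expR (- (b * x))).
  rewrite (_ : expR _ = - b^-1 *: (expR (- (b * x)) * (- b))); last first.
    by rewrite /GRing.scale/= mulrCA mulrNN mulVf ?mulr1// gt_eqF.
  apply: is_deriveZ.
  apply: (@is_derive1_comp _ expR (fun t => - (b * t))).
  rewrite -[- b]mulr1 mulNr; apply: is_deriveN; exact: is_deriveZ.
have cF (x : R) : {for x, continuous F}.
  by apply: differentiable_continuous; apply/derivable1_diffP; have [] := dF x.
have ce (x : R) : {for x, continuous (fun t => expR (- (b * t)))}.
  apply: (@continuous_comp _ _ _ (fun t => - (b * t)) expR);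
    last exact: continuous_expR.
  by apply: cvgN; apply: cvgMr; exact: cvg_id.
have h1 (x : R) : 1 <= x -> 0 <= expR (- (b * x)) by move=> _; exact: expR_ge0.
have h2 : {within `[1, +oo[, continuous (fun t : R => expR (- (b * t)))}.
  by apply: continuous_subspaceT => x; exact: ce.
have h3 : F x @[x --> +oo] --> 0.
  rewrite -[0](mulr0 (- b^-1)); apply: cvgMr.
  apply: (@cvg_comp _ _ _ (fun x => b * x) (fun x => expR (- x)) _
    (pinfty_nbhs R)); last exact: cvgr_expR.
  exact: gt0_cvgMry.
have h4 (x : R) : 1 < x -> derivable F x 1 by move=> _; have [] := dF x.
have h5 : F x @[x --> 1^'+] --> F 1 by apply: cvg_at_right_filter; exact: cF.
have h6 : {in `]1, +oo[, F^`()%classic =1 (fun t => expR (- (b * t)))}.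
  by move=> x _; rewrite derive1E; have [] := dF x.
split; first exact: ge0_integrable_FTC2y h1 h2 h3 h4 h5 h6.
rewrite (Rintegral_ge0_continuous_FTC2y h1 h2 h3 h4 h5 h6).
by rewrite /F mulr1 sub0r mulNr opprK.
Qed.

Lemma expR_powR_integrable (a z : R) : 0 < a -> 0 <= z ->
  mu.-integrable `[1, +oo[
    (EFin \o (fun t : R => expR (- (z * t)) * t `^ (- (a + 1)))).
Proof.
move=> a0 z0; have [int _] := integral_powR_tail a a0.
apply: le_integrable int => //.
  apply/measurable_EFinP; apply: measurable_funM => //.
    apply: measurable_funTS; apply: measurableT_comp => //.
    by apply: measurableT_comp => //; exact: measurable_funM.
  by apply: measurable_funTS; exact: measurable_powR.
move=> t/=; rewrite in_itv/= andbT => t1; rewrite lee_fin.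
rewrite normrM ler_piMl// ger0_norm ?expR_ge0// -expR0 ler_expR.
by rewrite oppr_le0 mulr_ge0// (le_trans _ t1).
Qed.

(* The absolute value extends the integrand past z = 0 with the same dominating
   function, as [continuity_under_integral] requires an open interval around z. *)
Lemma continuous_expint_norm (a : R) : 0 < a ->
  continuous (fun z : R => expint (a + 1) `|z|).
Proof.
move=> a0 x.
have [int _] := integral_powR_tail a a0.
rewrite /expint.
pose f (z t : R) := expR (- (`|z| * t)) * t `^ (- (a + 1)) : R.
have := @continuity_under_integral R _ _ mu f `[1, +oo[ _ (x - 1) (x + 1) _ _ _ int.
apply.
- by [].
- by move=> z _; exact: expR_powR_integrable.
- apply: aeW => t _ z _.
  apply: cvgMl.
  apply: (@continuous_comp _ _ _ (fun z => - (`|z| * t)) expR);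
    last exact: continuous_expR.
  by apply: cvgN; apply: cvgMl; exact: norm_continuous.
- move=> z _; apply: aeW => t/=; rewrite in_itv/= andbT => t1.
  rewrite /f normrM [X in _ * X]ger0_norm ?powR_ge0// ler_piMl ?powR_ge0//.
  rewrite ger0_norm ?expR_ge0// -expR0 ler_expR.
  by rewrite oppr_le0 mulr_ge0// (le_trans _ t1).
- by rewrite inE/= in_itv/= ltrBlDr ltrDl ltr01.
Qed.

Lemma scaled_expint0 (a : R) : 0 < a -> scaled_expint (a + 1) 0 = a^-1.
Proof.
move=> a0; have [_ <-] := integral_powR_tail a a0.
rewrite /scaled_expint /expint expR0 mul1r; apply: eq_Rintegral => t _.
by rewrite mul0r oppr0 expR0 mul1r.
Qed.

(** For [t >= 1] the power factor is at most 1, which leaves the integral of [expR (- (z * t))]; the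
    prefactor [expR z] cancels its [expR (- z)]. *)
Lemma scaled_expint_le (a z : R) : 0 < a -> 0 < z ->
  scaled_expint (a + 1) z <= z^-1.
Proof.
move=> a0 z0; have [int e] := integral_expR_tail z z0.
have -> : z^-1 = expR z * (z^-1 * expR (- z)).
  by rewrite mulrCA expRxMexpNx_1 mulr1.
rewrite /scaled_expint ler_pM2l ?expR_gt0// /expint -e.
apply: le_Rintegral => //; first by apply: expR_powR_integrable => //; exact: ltW.
move=> t/=; rewrite in_itv/= andbT => t1.
rewrite ler_piMr ?expR_ge0//.
by rewrite -[leRHS](powRr0 t); apply: ler_powR => //; rewrite oppr_le0 addr_ge0 ?ltW.
Qed.

Lemma scaled_expint_surj (a c : R) : 0 < a -> 0 < c -> c < a^-1 ->
  exists2 z, 0 <= z & scaled_expint (a + 1) z = c.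
Proof.
move=> a0 c0 ca.
have ci0 : 0 < c^-1 by rewrite invr_gt0.
(* [G] agrees with [scaled_expint (a + 1)] on [z >= 0] and is continuous on the whole line. *)
pose G (z : R) := expR z * expint (a + 1) `|z|.
have GE z : 0 <= z -> G z = scaled_expint (a + 1) z.
  by move=> z0; rewrite /G ger0_norm.
(* The right endpoint comes from the bound [z^-1], which equals [c] at [z = c^-1]; at 0 the value
   [a^-1] exceeds [c]. *)
have [||z] := @IVT R G 0 c^-1 c (ltW ci0).
- apply: continuous_subspaceT => z; apply: cvgM; first exact: continuous_expR.
  exact: continuous_expint_norm.
- rewrite !GE ?(ltW ci0)// scaled_expint0//.
  have := scaled_expint_le a c^-1 a0 ci0; rewrite invrK => h.
  by rewrite ge_min h orbT le_max (ltW ca).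
- rewrite in_itv/= => /andP[z0 _] Gz; exists z => //.
  by rewrite -GE.
Qed.

(** As [c] is attained, the pseudo-inverse returns a genuine preimage in the half-line; it cannot be
    0, where the value is [a^-1 > c]. *)
Lemma scaled_expint_inv_gt0 (a c : R) : 0 < a -> 0 < c -> c < a^-1 ->
  0 < scaled_expint_inv (a + 1) c.
Proof.
move=> a0 c0 ca; have [z z0 zc] := scaled_expint_surj a c a0 c0 ca.
have cim : c \in scaled_expint (a + 1) @` [set z | 0 <= z].
  by rewrite inE; exists z.
have := pinvK (fun=> point) cim; rewrite -/(scaled_expint_inv (a + 1)) => invE.
have : 0 <= scaled_expint_inv (a + 1) c.
  have := @surjpinv_image_sub _ _ (fun=> point) [set z : R | 0 <= z] _ _
    (@subset_refl _ (scaled_expint (a + 1) @` [set z | 0 <= z])).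
  by apply; exists c => //; rewrite -inE.
rewrite le_eqVlt => /predU1P[h|//].
move: invE; rewrite -h scaled_expint0// => ac.
by rewrite ac ltxx in ca.
Qed.

End ScaledExpint.

(** * Closed form of the filter and positivity of the inflation factors *)

Lemma sum_sq_gt0 (R : realType) (m : nat -> R) i : 0 < sum_sq m i.
Proof.
(* The term [l = 0] is the square of an empty product, hence 1. *)
rewrite /sum_sq big_ord_recl /model_prod big_ord0 expr1n.
by rewrite ltr_wpDr// sumr_ge0// => j _; rewrite sqr_ge0.
Qed.

Lemma filter_forecastS (R : realType) (r : R) (m y : nat -> R) (x0 v : R) i :
  0 < r -> 0 < v ->
  filter_forecast r m y x0 v i.+1 =
    (model_prod m i.+1 * (r * x0 + v * sum_obs m y i) / (sum_sq m i * v + r),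
     model_prod m i.+1 ^+ 2 * v * r / (sum_sq m i * v + r)).
Proof.
move=> r0 v0.
have denom k : sum_sq m k * v + r != 0.
  by rewrite gt_eqF// addr_gt0// mulr_gt0// sum_sq_gt0.
elim: i => [|i IHi].
  have := denom 0%N.
  rewrite /= /forecast /analysis /kalman_gain /sum_sq /sum_obs /model_prod /=.
  rewrite !(big_ord_recl, big_ord0) /= expr1n addr0 mul1r => d.
  by congr pair; field.
have IH : filter_forecast r m y x0 v i.+2 =
    forecast (m i.+1) (analysis r (y i.+1) (filter_forecast r m y x0 v i.+1)).
  by [].
rewrite {}IH {}IHi.
have := denom i.+1; have := denom i.
have -> : sum_sq m i.+1 = sum_sq m i + model_prod m i.+1 ^+ 2.
  by rewrite /sum_sq big_ord_recr.
have -> : sum_obs m y i.+1 = sum_obs m y i + model_prod m i.+1 * y i.+1.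
  by rewrite /sum_obs big_ord_recr.
have -> : model_prod m i.+2 = model_prod m i.+1 * m i.+1.
  by rewrite /model_prod big_ord_recr.
rewrite /forecast /analysis /kalman_gain /=.
move: (sum_sq m i) (sum_obs m y i) (model_prod m i.+1) => S B M d d'.
(* This is the denominator [p + r] of the gain after clearing [S * v + r] from the closed form of
   [p]; up to the factor [r] it is the denominator of the next step. *)
have d'' : M ^+ 2 * v * r + r * (S * v + r) != 0.
  rewrite (_ : _ + _ = r * ((S + M ^+ 2) * v + r)); last by ring.
  by rewrite mulf_neq0// gt_eqF.
by congr pair; field; rewrite ?d ?d' ?d''.
Qed.

Lemma opt_inflation_gt0 (R : realType) (alpha r p0 : R) (m : nat -> R) i :
  0 < alpha -> 0 < r -> 0 < p0 -> 0 < opt_inflation alpha r p0 m i.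
Proof.
move=> a0 r0 p00; have Sp0 : 0 < sum_sq m i * p0 by rewrite mulr_gt0// sum_sq_gt0.
have Spr0 : 0 < sum_sq m i * p0 + r by rewrite addr_gt0.
rewrite /opt_inflation invr_gt0 mulr_gt0//; first by rewrite divr_gt0// mulr_gt0.
apply: scaled_expint_inv_gt0 => //; first by rewrite divr_gt0// mulr_gt0.
(* The argument of the inverse is [alpha^-1] times [S p0 / (S p0 + r)], a ratio strictly below 1
   because [r > 0]. *)
rewrite invfM mulrCA gtr_pMr ?invr_gt0//.
by rewrite ltr_pdivrMr// mul1r ltrDl.
Qed.

Theorem mainTheorem5 (R : realType) (m y : nat -> R) (r p0 x0 alpha : R)
  (hm : forall i, m i != 0) (hr : 0 < r) (hp0 : 0 < p0) (halpha : 1 < alpha) :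
  forall i : nat,
    let theta := opt_inflation alpha r p0 m in
    spenkf_sequential alpha r p0 m y x0 i = spenkf r m y x0 (theta i * p0) i /\
    analysis r (y i) (spenkf_sequential alpha r p0 m y x0 i) =
      analysis r (y i) (spenkf r m y x0 (theta i * p0) i).
Proof.
move=> i theta.
suff H : spenkf_sequential alpha r p0 m y x0 i = spenkf r m y x0 (theta i * p0) i.
  by rewrite H.
have theta_gt0 k : 0 < theta k.
  by apply: opt_inflation_gt0 => //; exact: lt_trans halpha.
(* At step 0 both sides reduce to [(x0, theta 0 * p0)], since [phi_0] is [theta_0]. *)
elim: i => [//|i IHi].
have tp0 k : 0 < theta k * p0 by rewrite mulr_gt0.
(* By the induction hypothesis, the state about to be corrected is the forecast at [i.+1] of the run
   started from [theta i * p0], so the closed form applies to it. *)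
have step : spenkf_sequential alpha r p0 m y x0 i.+1 =
    (mean_correction alpha r p0 x0 m y i.+1 +
       (spenkf r m y x0 (theta i * p0) i.+1).1,
     inflation_factor alpha r p0 m i.+1 *
       (spenkf r m y x0 (theta i * p0) i.+1).2).
  by rewrite [in RHS]/spenkf /= -/(spenkf r m y x0 (theta i * p0) i) -IHi.
rewrite {}step /spenkf !filter_forecastS// /inflation_factor /mean_correction.
rewrite -/theta /=.
have d k : sum_sq m i * theta k * p0 + r != 0.
  by rewrite gt_eqF// addr_gt0// -mulrA mulr_gt0// sum_sq_gt0.
have ti : theta i != 0 by rewrite gt_eqF.
have := d i; have := d i.+1.
move: (theta i) (theta i.+1) ti (sum_sq m i) (sum_obs m y i) => t t' ti S B d1 d2.
(* The closed form at [v = t * p0] associates the product differently from the correction factors,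
   so [field] meets both shapes of each denominator. *)
have e1 : S * (t * p0) + r != 0 by rewrite mulrA.
have e2 : S * (t' * p0) + r != 0 by rewrite mulrA.
by congr pair; field; rewrite ?d1 ?d2 ?e1 ?e2 ?ti.
Qed.
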